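(* Let $G$ be an amenable group, $\mathbb{K}$ a field, and $V$ a finite-dimensional vector space over $\mathbb{K}$. Then every strongly irreducible linear subshift of finite type $X \subset V^G$ is L-surjunctive.
   Context: For a group $G$ and a set $A$, $A^G$ is the set of all maps (configurations) $x \colon G \to A$, equipped with the prodiscrete topology (the product topology obtained from the discrete topology on each factor $A$) and with the left $G$-action $(gx)(h) = x(g^{-1}h)$. A subshift is a closed $G$-invariant subset $X \subset A^G$. For $\Omega \subset G$, $x\vert_\Omega$ denotes restriction. Strong irreducibility: for a finite subset $\Delta \subset G$, a subshift $X \subset A^G$ is $\Delta$-irreducible if, whenever $\Omega_1,\Omega_2$ are finite subsets of $G$ such that there is no $g \in \Omega_2$ with $g\Delta \cap \Omega_1 \neq \varnothing$, then for all $x_1,x_2 \in X$ there is $x \in X$ with $x\vert_{\Omega_1} = x_1\vert_{\Omega_1}$ and $x\vert_{\Omega_2} = x_2\vert_{\Omega_2}$. $X$ is strongly irreducible if it is $\Delta$-irreducible for some finite $\Delta \subset G$. Finite type: for a finite $D \subset G$ and $L \subset A^D$, put $X_G(D,L) = \{x \in A^G : (g^{-1}x)\vert_D \in L \text{ for all } g \in G\}$. A subshift $X$ is of finite type if $X = X_G(D,L)$ for some finite $D \subset G$ and some $L \subset A^D$. Cellular automata: a map $\tau \colon X \to Y$ between subshifts $X,Y \subset A^G$ is a cellular automaton if there are a finite subset $M \subset G$ and a map $\mu \colon A^M \to A$ with $\tau(x)(g) = \mu((g^{-1}x)\vert_M)$ for all $x \in X$, $g \in G$. Linear setting: if $V$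 is a vector space over $\mathbb{K}$, $V^G$ has its product vector space structure; a linear subshift is a subshift $X \subset V^G$ that is a vector subspace of $V^G$, and a linear cellular automaton between linear subshifts is a cellular automaton that is a $\mathbb{K}$-linear map. A linear subshift $X \subset V^G$ is L-surjunctive if every injective linear cellular automaton $\tau \colon X \to X$ is surjective. *)

(* Defs.v *)
From HB Require Import structures.
From mathcomp Require Import all_boot all_order all_algebra finmap.
From mathcomp Require Import boolp classical_sets functions.
From mathcomp Require Import topology.

Set Implicit Arguments.
Unset Strict Implicit.
Unset Printing Implicit Defensive.

Import GRing.Theory.

Local Open Scope classical_set_scope.
Local Open Scope ring_scope.

(* The right Folner condition, equivalent to the existence of a right Folner
   net: index the net by the pairs (K, eps). *)
Definition amenable (G : groupType) : Prop :=
  forall (K : {fset G}) (eps : rat), 0 < eps ->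
  exists2 F : {fset G}, F != fset0%fset &
    forall k, k \in K ->
      #|` (F `\` [fset (f * k)%g | f in F])%fset|%:R <= eps * #|` F |%:R.

Section Configurations.
Variables (G : groupType) (A : choiceType).
Implicit Types (X Y : set (G -> A)) (x : G -> A).

Definition shift (g : G) x : G -> A := fun h => x (g^-1 * h)%g.

Definition restr (D : {fset G}) x : D -> A := fun d => x (val d).
Arguments restr D x : clear implicits.

Definition shift_invariant X : Prop := forall g x, X x -> X (shift g x).

Definition subshift X : Prop :=
  closed (X : set {ptws G -> discrete_topology A}) /\ shift_invariant X.

Definition irreducible_wrt (Delta : {fset G}) X : Prop :=
  forall Omega1 Omega2 : {fset G},
    ~ (exists2 g, g \in Omega2 &
        ([fset (g * d)%g | d in Delta] `&` Omega1 != fset0)%fset) ->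
    forall x1 x2, X x1 -> X x2 ->
      exists x, [/\ X x, restr Omega1 x = restr Omega1 x1
                       & restr Omega2 x = restr Omega2 x2].

Definition strongly_irreducible X : Prop :=
  exists Delta : {fset G}, irreducible_wrt Delta X.

Definition sft (D : {fset G}) (L : set (D -> A)) : set (G -> A) :=
  [set x | forall g : G, L (restr D (shift g^-1%g x))].

Definition finite_type X : Prop :=
  exists (D : {fset G}) (L : set (D -> A)), X = sft L.

(* A map X -> Y is a total map on configurations sending X into Y; its values
   outside X are irrelevant everywhere below. *)
Definition cellular_automaton X Y (tau : (G -> A) -> (G -> A)) : Prop :=
  set_fun X Y tau /\
  exists (M : {fset G}) (mu : (M -> A) -> A),
    forall x, X x -> forall g, tau x g = mu (restr M (shift g^-1%g x)).

End Configurations.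

Section Linear.
Variables (G : groupType) (K : fieldType) (V : vectType K).
Implicit Types (X Y : set (G -> V)).

Definition linear_subshift X : Prop :=
  subshift X /\ submod_closed [in X].

Definition linear_cellular_automaton X Y (tau : (G -> V) -> (G -> V)) : Prop :=
  cellular_automaton X Y tau /\
  forall (a : K) x y, X x -> X y -> tau (a *: x + y) = a *: tau x + tau y.

Definition L_surjunctive X : Prop :=
  forall tau, linear_cellular_automaton X X tau ->
    set_inj X tau -> set_surj X X tau.

End Linear.

(* Main.v *)
Require Import Defs.
From mathcomp Require Import all_boot all_order all_algebra finmap.
From mathcomp Require Import boolp classical_sets functions topology.
From mathcomp Require Import zify.

Set Implicit Arguments.
Unset Strict Implicit.
Unset Printing Implicit Defensive.

Import Order.TTheory GRing.Theory Num.Theory.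

(** Suppose that the injective linear cellular automaton [tau] of [X] is not
onto, and write [Z] for its image. For a finite window [F'], let [wdim F' X] be
the dimension of the space of restrictions to [F'] of the elements of [X]. The
contradiction comes from comparing [wdim F' X] and [wdim F' Z] on a Folner
window, in three steps.

- [Z] misses a finite pattern. If some [y] in [X] is not in [Z], then already on
  some finite [Omega] it agrees with no element of [Z] ([image_closed]). Since
  the alphabet may be infinite, this uses linear compactness in place of
  compactness: finitely many affine conditions at a time can be solved inside a
  finite-dimensional space, where a decreasing sequence of affine subspaces is
  stationary ([affine_directed_common_point]), and the partial solutions are
  assembled by the lemma of Zorn ([linear_compactness]).

- Upper bound on [Z] ([missing_pattern_dim]). By strong irreducibility the
  missing pattern can be placed independently on many well separated translates
  of [Omega]; each of them costs [Z] at least one dimension. As a set [F]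
  contains at least [#|F| / c] separated points, [wdim F' Z] is smaller than
  [wdim F' X] by at least [#|F| / c], with [c] independent of [F].

- Lower bound on [Z] ([injective_dim]). Strong irreducibility and finite type
  together allow an element of [X] to be cut off to [0] just outside [F]
  ([truncate_to_finite]). So the elements of [X] with support near [F] form a
  space of dimension at least [wdim F' X] minus a boundary term, and [tau]
  embeds it into the restrictions of [Z] to a slightly larger window [F'].

Hence [#|F|] is at most a constant times the number of points of [F'] outside
[F]. Here [F'] is the product of [F] with a fixed finite set, so amenability
gives an [F] for which this is false ([amenable_product]). *)

Local Open Scope classical_set_scope.
Local Open Scope ring_scope.

(** * Linear sets and their dimension *)

Section Subspaces.
Variable K : fieldType.
Implicit Types (E : lmodType K) (V W : vectType K).

Definition linear_set E (P : set E) : Prop :=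
  P 0 /\ forall a x y, P x -> P y -> P (a *: x + y).

Definition linear_on E (F : lmodType K) (P : set E) (f : E -> F) : Prop :=
  forall a x y, P x -> P y -> f (a *: x + y) = a *: f x + f y.

Lemma linear_setB E (P : set E) x y : linear_set P -> P x -> P y -> P (x - y).
Proof. by move=> [_ lP] Px Py; rewrite addrC -scaleN1r; exact: lP. Qed.

Lemma linear_set_sum E (P : set E) n (k : 'I_n -> K) (x : 'I_n -> E) :
  linear_set P -> (forall i, P (x i)) -> P (\sum_(i < n) k i *: x i).
Proof.
move=> [P0 lP] Px; elim: n k x Px => [|n IH] k x Px; first by rewrite big_ord0.
by rewrite big_ord_recl; apply: lP => //; exact: IH.
Qed.

Lemma linear_on0 E (F : lmodType K) (P : set E) (f : E -> F) :
  linear_set P -> linear_on P f -> f 0 = 0.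
Proof.
move=> [P0 _] lf; have := lf (-1) 0 0 P0 P0.
by rewrite scaler0 addr0 scaleN1r addNr.
Qed.

Lemma linear_onB E (F : lmodType K) (P : set E) (f : E -> F) x y :
  linear_on P f -> P x -> P y -> f (x - y) = f x - f y.
Proof.
by move=> lf Px Py; rewrite addrC -scaleN1r lf// scaleN1r addrC.
Qed.

Lemma linear_on_sum E (F : lmodType K) (P : set E) (f : E -> F) n
    (k : 'I_n -> K) (x : 'I_n -> E) :
  linear_set P -> linear_on P f -> (forall i, P (x i)) ->
  f (\sum_(i < n) k i *: x i) = \sum_(i < n) k i *: f (x i).
Proof.
move=> sP lf Px; elim: n k x Px => [|n IH] k x Px.
  by rewrite !big_ord0 (linear_on0 sP lf).
by rewrite !big_ord_recl lf ?IH//; exact: linear_set_sum.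
Qed.

Lemma linear_set_image E (F : lmodType K) (P : set E) (f : E -> F) :
  linear_set P -> linear_on P f -> linear_set (f @` P).
Proof.
move=> sP lf; split; first by exists 0; [case: sP|exact: linear_on0 lf].
move=> a _ _ [x Px <-] [y Py <-]; exists (a *: x + y); last exact: lf.
by case: sP => _; exact.
Qed.

(** A linear subset contained in a finite-dimensional space is a subspace: any
[vspace] of maximal dimension inside [P] absorbs every vector of [P]. *)
Lemma linear_set_vspace W (P : set W) :
  linear_set P -> exists U : {vspace W}, forall w, (w \in U) <-> P w.
Proof.
move=> sP.
pose Q n :=
  `[< exists2 U : {vspace W}, \dim U = n & forall w, w \in U -> P w >].
have Q0 : exists n, Q n.
  exists (\dim (0%VS : {vspace W})); apply/asboolP; exists 0%VS => // w.
  by rewrite memv0 => /eqP ->; case: sP.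
have Qb n : Q n -> (n <= \dim (fullv : {vspace W}))%N.
  by move=> /asboolP[U <- _]; exact/dimvS/subvf.
case: (ex_maxnP Q0 Qb) => n /asboolP[U dU UP] maxn.
exists U => w; split=> [|Pw]; first exact: UP.
have : Q (\dim (<[w]> + U)%VS).
  apply/asboolP; exists (<[w]> + U)%VS => //.
  move=> _ /memv_addP[_ /vlineP[a ->] [u Uu ->]].
  by case: sP => _; apply=> //; exact: UP.
move=> /maxn; rewrite -dU => le_dim.
have /eqP -> : U == (<[w]> + U)%VS by rewrite eqEdim addvSr.
exact: (subvP (addvSl _ _)) (memv_line w).
Qed.

(** The [vspace] with the same elements as [P], and a junk value if [P] is not
linear; it makes [\dim] available for sets given by a [Prop]-valued predicate. *)
Definition vspace_of W (P : set W) : {vspace W} :=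
  xget 0%VS [set U : {vspace W} | forall w, (w \in U) <-> P w].

Lemma vspace_ofP W (P : set W) w : linear_set P -> w \in vspace_of P <-> P w.
Proof.
move=> /linear_set_vspace[U UP]; rewrite /vspace_of.
by case: xgetP => [? _ /(_ w)//|/(_ U)].
Qed.

Lemma vspace_ofS W (P Q : set W) :
  linear_set P -> linear_set Q -> P `<=` Q -> (vspace_of P <= vspace_of Q)%VS.
Proof.
move=> sP sQ PQ; apply/subvP => w.
by move=> /(vspace_ofP _ sP)/PQ/(vspace_ofP _ sQ).
Qed.

(** If [ker g] is contained in [ker f] on [P], then [f] factors through [g]
there: preimages of a basis of the image of [f] have independent images
under [g]. The ambient space [E] may have infinite dimension. *)
Lemma rank_le E (P : set E) W W' (f : E -> W) (g : E -> W') :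
  linear_set P -> linear_on P f -> linear_on P g ->
  (forall x, P x -> g x = 0 -> f x = 0) ->
  (\dim (vspace_of (f @` P)) <= \dim (vspace_of (g @` P)))%N.
Proof.
move=> sP lf lg ker_gf.
have sfP := linear_set_image sP lf; have sgP := linear_set_image sP lg.
set U := vspace_of (f @` P); set U' := vspace_of _.
have lift i : {x | P x & f x = (vbasis U)`_i}.
  have /(vspace_ofP _ sfP)/cid2//: (vbasis U)`_i \in U.
  have [lti|gei] := ltnP i (size (vbasis U)); first exact/vbasis_mem/mem_nth.
  by rewrite nth_default ?mem0v.
pose x i := s2val (lift i); pose Px i : P (x i) := s2valP (lift i).
have fx i : f (x i) = (vbasis U)`_i := s2valP' (lift i).
have free_gx : free [tuple g (x i) | i < \dim U].
  apply/freeP => k; under eq_bigr do rewrite nth_mktuple.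
  rewrite -(linear_on_sum k sP lg (fun i => Px i)).
  move=> /(ker_gf _ (linear_set_sum k sP (fun i => Px i))).
  rewrite (linear_on_sum k sP lf (fun i => Px i)).
  under eq_bigr do rewrite fx.
  by apply/freeP; exact: basis_free (vbasisP U).
rewrite -[leqLHS](size_tuple [tuple g (x i) | i < \dim U]) -(eqP free_gx).
apply/dimvS/span_subvP => _ /mapP[i _ ->]; apply/(vspace_ofP _ sgP).
by exists (x i).
Qed.

(** A downward directed family of nonempty affine subspaces of [V] has a least
member, any one whose direction space has minimal dimension. *)
Lemma affine_directed_common_point V (I : Type) (J : set I) (A : I -> set V) :
  J !=set0 ->
  (forall i, J i -> A i !=set0) ->
  (forall i, J i -> forall a x y z, A i x -> A i y -> A i z ->
     A i (a *: (x - y) + z)) ->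
  (forall i j, J i -> J j -> exists2 k, J k & A k `<=` A i `&` A j) ->
  exists v, forall i, J i -> A i v.
Proof.
move=> [i1 Ji1] A0 affA dirA.
pose D i : set V := [set d | exists p, [/\ A i p.1, A i p.2 & d = p.1 - p.2]].
have sD i : J i -> linear_set (D i).
  move=> Ji; split.
    by have [v Av] := A0 _ Ji; exists (v, v); split; rewrite ?subrr.
  move=> a _ _ [[x y] [/= Ax Ay ->]] [[x' y'] [/= Ax' Ay' ->]].
  exists (a *: (x - y) + x', y'); split=> //=; last by rewrite addrA.
  exact: affA.
pose Q n := `[< exists2 i, J i & \dim (vspace_of (D i)) = n >].
have Q0 : exists n, Q n.
  by exists (\dim (vspace_of (D i1))); apply/asboolP; exists i1.
case: (ex_minnP Q0) => n /asboolP[i Ji <-] minD.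
have [v Av] := A0 _ Ji; exists v => j Jj.
have [k Jk subk] := dirA _ _ Ji Jj.
(* As [k] lies below [i], minimality forces [D k] = [D i]; so [A k] and [A i] are
   the same affine subspace, since they share the point [w]. *)
have [w Aw] := A0 _ Jk; have [Aiw Ajw] := subk _ Aw.
have DkDi : (vspace_of (D k) <= vspace_of (D i))%VS.
  apply: (vspace_ofS (sD _ Jk) (sD _ Ji)) => _ [p [/subk[? _] /subk[? _] ->]].
  by exists p.
have : v - w \in vspace_of (D i).
  by apply/(vspace_ofP _ (sD _ Ji)); exists (v, w).
have /eqP <- : vspace_of (D k) == vspace_of (D i).
  by rewrite eqEdim DkDi minD//; apply/asboolP; exists k.
move=> /(vspace_ofP _ (sD _ Jk))[[p q] [/= Akp Akq vw]].
rewrite -(subrK w v) vw -[p - q]scale1r.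
by apply: (subk _ _).2; exact: affA.
Qed.

End Subspaces.

(** * Linear compactness *)

(** The elements of [X] agreeing with [x] on finite sets generate a filter that
converges pointwise to [x]. *)
Lemma closed_ptws (T A : choiceType) (X : set (T -> A)) x :
  closed (X : set {ptws T -> discrete_topology A}) ->
  (forall s : seq T, exists2 x', X x' & {in s, x' =1 x}) -> X x.
Proof.
move=> clX appr.
pose F := filter_from setT
  (fun s : seq T => [set x' | X x' /\ {in s, x' =1 x}]).
have FF : ProperFilter F.
  apply: filter_from_proper; last first.
    by move=> s _; have [x' ? ?] := appr s; exists x'.
  apply: filter_from_filter; first by exists [::].
  move=> s t _ _; exists (s ++ t) => // x' [Xx' x'x]; split; split=> // g gs.
    by apply: x'x; rewrite mem_cat gs.
  by apply: x'x; rewrite mem_cat gs orbT.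
apply: (@closed_cvg _ {ptws T -> discrete_topology A} F FF id) clX _ _ _.
  by exists [::] => // x' [].
apply/(@pointwise_cvgP (discrete_topology T) (discrete_topology A)) => t B.
rewrite nbhs_principalE => Bx; exists [:: t] => // x' [_ x'x].
by rewrite /= x'x ?mem_head//; exact: Bx.
Qed.

(** The linear substitute for the compactness of [A^G] with [A] finite: the
closures of the members of a directed family of nonempty affine sets have a
common point. It is built coordinate by coordinate: a partial configuration,
encoded as a set [Q] of pairs (coordinate, value), is good if each of its finite
parts extends to a point of each [C i]. A maximal good [Q] is defined at every
coordinate [t], because the values allowed at [t] by the members of the family
and the finite parts of [Q] are directed affine subspaces of [V]. *)
Lemma linear_compactness (K : fieldType) (V : vectType K) (T : choiceType)
    (I : Type) (C : I -> set (T -> V)) :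
  inhabited I ->
  (forall i, C i !=set0) ->
  (forall i a x y z, C i x -> C i y -> C i z -> C i (a *: (x - y) + z)) ->
  (forall i j, exists k, C k `<=` C i `&` C j) ->
  exists x, forall i (s : seq T), exists2 x', C i x' & {in s, x' =1 x}.
Proof.
move=> [i0] C0 affC dirC.
pose agree (s : seq (T * V)) :=
  [set x : T -> V | {in s, forall p, x p.1 = p.2}].
pose good (Q : set (T * V)) :=
  forall i s, {in s, forall p, Q p} -> C i `&` agree s !=set0.
have [Q [goodQ maxQ]] : exists Q, good Q /\ forall B, Q `<` B -> ~ good B.
  apply: Zorn_bigcup => F Fgood totF i s sF.
  have [F0|/set0P F0] := eqVneq F set0.
    have s0 : s = [::].
      by case: s sF => // p s /(_ p (mem_head _ _)); rewrite F0 => -[].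
    by have [x Cx] := C0 i; exists x; rewrite s0; split.
  have [Y FY sY] : exists2 Y, F Y & {in s, forall p, Y p}.
    elim: s sF => [|p s IH] sF; first by have [Y FY] := F0; exists Y.
    have [|Y FY sY] := IH; first by move=> q qs; apply: sF; rewrite inE qs orbT.
    have [Y' FY' Y'p] := sF p (mem_head _ _).
    have [/= YY'|Y'Y] := totF _ _ FY FY'.
      by exists Y' => // q; rewrite inE => /predU1P[->//|/sY/YY'].
    by exists Y => // q; rewrite inE => /predU1P[->|/sY//]; exact: Y'Y.
  exact: Fgood FY i s sY.
have totalQ t : exists v, Q (t, v).
  pose J := [set p : I * seq (T * V) | {in p.2, forall q, Q q}].
  pose A (p : I * seq (T * V)) := [set x t | x in C p.1 `&` agree p.2].
  have [||||v Av] := @affine_directed_common_point _ V _ J A.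
  - by exists (i0, [::]).
  - move=> [i s] Js; have [x Cx] := goodQ i s Js; by exists (x t), x.
  - move=> [i s] _ a _ _ _ [x [Cx sx] <-] [y [Cy sy] <-] [z [Cz sz] <-].
    exists (a *: (x - y) + z) => //; split; first exact: affC.
    move=> p ps; rewrite -(sz _ ps) /= !fctE (sx _ ps) (sy _ ps).
    by rewrite subrr scaler0 add0r.
  - move=> [i s] [j u] Js Ju; have [k Ck] := dirC i j.
    exists (k, s ++ u) => /=.
      by move=> q; rewrite /= mem_cat => /orP[/Js|/Ju].
    move=> _ [x [/Ck[Ci Cj] su] <-]; split; exists x => //; split=> // p ps.
      by apply: su; rewrite mem_cat ps.
    by apply: su; rewrite mem_cat ps orbT.
  exists v; apply: contrapT => nQ.
  apply: (maxQ (Q `|` [set (t, v)])).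
    by split=> [p|/(_ (t, v)) Qtv]; [left|apply/nQ/Qtv; right].
  move=> i s sQ; pose s' := [seq p <- s | p != (t, v)].
  have [|x [Cx s'x] xt] := Av (i, s').
    by move=> p; rewrite mem_filter => /andP[/eqP ptv /sQ[]].
  exists x; split=> // p ps; have [->//|ptv] := eqVneq p (t, v).
  by apply: s'x; rewrite mem_filter ptv.
have [x Qx] := choice totalQ.
exists x => i s.
have [|x' [Cx' sx']] := goodQ i [seq (t, x t) | t <- s].
  by move=> _ /mapP[t _ ->].
by exists x' => // t ts; exact: (sx' (t, x t) (map_f _ ts)).
Qed.

(** * Products of finite subsets of a group *)

Definition mul_fset (G : groupType) (F S : {fset G}) : {fset G} :=
  [fset (f * s)%g | f in F, s in S]%fset.

Definition inv_fset (G : groupType) (S : {fset G}) : {fset G} :=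
  [fset s^-1%g | s in S]%fset.

Local Notation "F ** S" := (mul_fset F S) (at level 40, left associativity).

Section Groups.
Variable G : groupType.
Implicit Types (F S : {fset G}).

Lemma mul_fsetP F S g :
  reflect (exists f s, [/\ f \in F, s \in S & g = f * s]%g) (g \in F ** S).
Proof.
apply: (iffP (imfset2P _ _ _ _ _)) => [[f Ff [s Ss ->]]|[f [s [Ff Ss ->]]]].
  by exists f, s.
by exists f => //; exists s.
Qed.

Lemma mem_mul_fset F S f s : f \in F -> s \in S -> (f * s)%g \in F ** S.
Proof. by move=> Ff Ss; apply/mul_fsetP; exists f, s. Qed.

Lemma inv_fsetE S g : (g \in inv_fset S) = (g^-1%g \in S).
Proof.
apply/imfsetP/idP => [[s Ss ->]|Sg]; first by rewrite invgK.
by exists g^-1%g => //; rewrite invgK.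
Qed.

(** The Folner condition for the inverses of the elements of [S], summed over
[S], bounds the number of points that a product by [S] adds to [F]. *)
Lemma amenable_product S (N : nat) : amenable G ->
  exists F : {fset G}, (N * #|` (F ** S `\` F)%fset| < #|` F |)%N.
Proof.
move=> amG; pose eps : rat := ((N * #|` S|).+1%:R)^-1.
have eps0 : 0 < eps by rewrite invr_gt0 ltr0n.
have [F F0 folF] := amG (inv_fset S) eps eps0; exists F => //.
(* Right translation by [s] sends [bd s] onto the part of [F s] outside [F]. *)
pose bd s := [fset f in F | (f * s)%g \notin F]%fset.
have bd_le s : s \in S -> ((N * #|` S|).+1 * #|` bd s| <= #|` F|)%N.
  move=> Ss; have := folF s^-1%g; rewrite inv_fsetE invgK => /(_ Ss).
  rewrite mulrC ler_pdivlMr ?ltr0n// -natrM ler_nat mulnC.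
  apply: leq_trans; rewrite leq_mul2l; apply/orP; right.
  apply/fsubset_leq_card/fsubsetP => f; rewrite !inE /= => /andP[Ff nfs].
  rewrite Ff andbT; apply: contra nfs => /imfsetP[h Fh ->].
  by rewrite mulgVK.
have cover : (#|` (F ** S `\` F)%fset| <= \sum_(s <- S) #|` bd s|)%N.
  have -> : (\sum_(s <- S) #|` bd s| =
      size [seq (f * s)%g | s <- S, f <- bd s])%N.
    by rewrite size_allpairs_dep sumnE big_map.
  apply: uniq_leq_size; first exact: fset_uniq.
  move=> g; rewrite inE => /andP[nFg /mul_fsetP[f [s [Ff Ss gE]]]].
  apply/allpairsPdep; exists s, f; split=> //.
  by rewrite !inE /= Ff -gE.
have : ((N * #|` S|).+1 * #|` (F ** S `\` F)%fset| <= #|` S| * #|` F|)%N.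
  apply: leq_trans (leq_mul (leqnn _) cover) _.
  rewrite big_distrr/= big_seq (leq_trans (@leq_sum _ _ _ _ _ bd_le))//.
  by rewrite -big_seq big_const_seq count_predT iter_addn_0 mulnC.
move: F0; rewrite -cardfs_gt0; case: #|` (F ** S `\` F)%fset| => [|b] F0.
  by rewrite !muln0.
by case: ltnP => //; nia.
Qed.
End Groups.

(** * Local rules: closed image and truncation *)

Section LocalMaps.
Variables (G : groupType) (K : fieldType) (V : vectType K).
Implicit Types (X : set (G -> V)) (x y : G -> V) (F S : {fset G}).

Lemma eq_restr F x y : @restr G V F x = @restr G V F y <-> {in F, x =1 y}.
Proof.
split=> [/funeqP xy g Fg|xy]; first exact: (xy [` Fg]%fset).
by apply/funext => g; exact/xy/valP.
Qed.

Lemma shift_restr F x y g :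
  {in F, forall h, x (g * h)%g = y (g * h)%g} ->
  @restr G V F (shift g^-1%g x) = @restr G V F (shift g^-1%g y).
Proof.
by move=> xy; apply/eq_restr => h Fh; rewrite /shift invgK; exact: xy.
Qed.

Lemma subshift_complete X x : subshift X ->
  (forall F, exists2 x', X x' & {in F, x' =1 x}) -> X x.
Proof.
move=> [clX _] appr; apply: closed_ptws clX _ => s.
have [x' Xx' x'x] := appr [fset g in s]%fset.
by exists x' => // g gs; apply: x'x; rewrite in_fset.
Qed.

(** The part of the definition of a cellular automaton with memory set [M] that
does not mention the local rule. *)
Definition local_on X (M : {fset G}) (tau : (G -> V) -> G -> V) : Prop :=
  forall x y g, X x -> X y ->
    {in M, forall m, x (g * m)%g = y (g * m)%g} -> tau x g = tau y g.

(** The configurations of [X] whose image agrees with [y] on finite sets form a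
directed affine family. A point of their closures lies in [X], which is closed,
and has image [y], because [tau] is local. *)
Lemma image_closed X M (tau : (G -> V) -> G -> V) y :
  subshift X -> linear_set X -> local_on X M tau -> linear_on X tau ->
  (forall F, exists2 x, X x & {in F, tau x =1 y}) ->
  exists2 x, X x & tau x = y.
Proof.
move=> shX sX loc lin appr.
pose C F := [set x | X x /\ {in F, tau x =1 y}].
have [||||x xP] := @linear_compactness K V G {fset G} C.
- exact: inhabits fset0.
- by move=> F; have [x] := appr F; exists x.
- move=> F a x1 x2 x3 [X1 F1] [X2 F2] [X3 F3].
  have X12 := linear_setB sX X1 X2; split; first by case: sX => _; exact.
  move=> g Fg; rewrite lin// (linear_onB lin)//.
  by rewrite !fctE F1// F2// F3// subrr scaler0 add0r.
- move=> F F'; exists (F `|` F')%fset => x [Xx Fx].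
  by split; split=> // g gF; apply: Fx; rewrite inE gF ?orbT.
have Xx : X x.
  apply: subshift_complete => // F; have [x' [Xx' _] x'x] := xP fset0 F.
  by exists x'.
exists x => //; apply/funext => g.
have [x' [Xx' x'y] x'x] := xP [fset g]%fset [seq (g * m)%g | m <- M].
rewrite -x'y ?inE//; apply: loc => // m Mm.
by rewrite x'x// map_f.
Qed.

(** Irreducibility yields [z] in [X] equal to [x] on [F] and to [0] on a thick
layer around [B], the product of [F] with the identity and the inverses of
[Delta]. Replacing [z] by [0] outside [B] stays in [X]: a translate of [D]
either sees [z] only or misses [B], so finite type applies. *)
Lemma truncate_to_finite (X : set (G -> V)) (D Delta F : {fset G})
    (L : set (D -> V)) x :
  X = sft L -> X 0 -> irreducible_wrt Delta X -> X x ->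
  exists2 x', X x' & {in F, x' =1 x} /\
    forall g, g \notin F ** (1%g |` inv_fset Delta)%fset -> x' g = 0.
Proof.
move=> XE X0 irr Xx.
set B := _ ** _.
have FB f : f \in F -> f \in B.
  by move=> Ff; rewrite -[f]mulg1 mem_mul_fset// !inE eqxx.
(* [N] contains every translate of [D] that meets [B]. *)
pose N := B ** inv_fset D ** D.
have [|z [Xz zx z0]] := irr F (N `\` B)%fset _ x 0 Xx X0.
  move=> [h]; rewrite inE => /andP[/negP nBh _] /fset0Pn[f].
  rewrite inE => /andP[/imfsetP[d /= Dd ->] Ff]; apply: nBh.
  by rewrite -[h](mulgK d) mem_mul_fset// inE inv_fsetE invgK Dd orbT.
move/eq_restr in zx; move/eq_restr in z0.
pose x' g := if g \in B then z g else 0.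
exists x'; last first.
  split=> g; last by rewrite /x' => /negPf ->.
  by move=> Fg; rewrite /x' FB// zx.
rewrite XE in Xz X0 *; move=> g.
have [/hasP[d Dd gdB]|/hasPn nB] := boolP (has (fun d => g * d \in B)%g D).
  have -> : @restr G V D (shift g^-1%g x') = @restr G V D (shift g^-1%g z).
    apply: shift_restr => d' Dd'; rewrite /x'; case: ifPn => // nBd'.
    rewrite z0// inE nBd' mem_mul_fset// -[g](mulgK d) mem_mul_fset//.
    by rewrite inv_fsetE invgK.
  exact: Xz.
have -> : @restr G V D (shift g^-1%g x') =
    @restr G V D (shift g^-1%g (0 : G -> V)).
  by apply: shift_restr => d Dd; rewrite /x' (negPf (nB _ Dd)).
exact: X0.
Qed.

End LocalMaps.

(** * Dimension of the restrictions to a window *)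

Section Windows.
Variables (G : groupType) (K : fieldType) (V : vectType K).
Implicit Types (X Z : set (G -> V)) (x y : G -> V) (F S : {fset G}).

Definition window F x : {ffun F -> V} := [ffun h => x (val h)].

Lemma window_linear F X : linear_on X (window F).
Proof. by move=> a x y _ _; apply/ffunP => h; rewrite !ffunE. Qed.

Lemma eq_window F x y : window F x = window F y <-> {in F, x =1 y}.
Proof.
split=> [/ffunP xy g Fg|xy].
  by have := xy [` Fg]%fset; rewrite !ffunE.
by apply/ffunP => h; rewrite !ffunE; exact/xy/valP.
Qed.

Definition wdim F X : nat := \dim (vspace_of (window F @` X)).

Lemma linear_window F X : linear_set X -> linear_set (window F @` X).
Proof. by move=> sX; apply: linear_set_image => //; exact: window_linear. Qed.

Lemma wdimS F X Z : linear_set X -> linear_set Z -> X `<=` Z ->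
  (wdim F X <= wdim F Z)%N.
Proof.
move=> sX sZ XZ; apply/dimvS/vspace_ofS; try exact: linear_window.
exact: image_subset.
Qed.

Lemma wdim_max F X : (wdim F X <= #|` F| * dim V)%N.
Proof.
rewrite (leq_trans (dimvS (subvf _)))// dimvf cardfE.
exact: leqnn.
Qed.

(** Modulo the restrictions of [X0], an element of [X] can be made to vanish on
[F], and then only its values on the rest of [F'] count. *)
Lemma wdim_approx F F' X X0 :
  linear_set X -> linear_set X0 ->
  (forall x, X x -> exists2 x0, X0 x0 & {in F, x0 =1 x}) ->
  (wdim F' X <= wdim F' X0 + #|` (F' `\` F)%fset| * dim V)%N.
Proof.
move=> sX sX0 appr.
pose N : set (G -> V) := [set x : G -> V | {in F, x =1 (0 : G -> V)}].
have sN : linear_set N.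
  by split=> // a x y Nx Ny g Fg; rewrite !fctE Nx// Ny// scaler0 addr0.
have NX := linear_window F' sN; have sX' := linear_window F' sX.
have sX0' := linear_window F' sX0.
apply: (@leq_trans (wdim F' X0 + wdim F' N)).
  apply: leq_trans (dimv_add_leqif _ _).1; apply/dimvS/subvP => w.
  move=> /(vspace_ofP _ sX')[x Xx <-]; have [x0 Xx0 x0x] := appr x Xx.
  have -> : window F' x = window F' x0 + window F' (x - x0).
    by apply/ffunP => h; rewrite !ffunE [RHS]addrC subrK.
  apply: memv_add; first by apply/(vspace_ofP _ sX0'); exists x0.
  apply/(vspace_ofP _ NX); exists (x - x0) => // g Fg.
  by rewrite !fctE x0x// subrr.
rewrite leq_add2l; apply: leq_trans (wdim_max (F' `\` F)%fset N).
apply: rank_le => //; try exact: window_linear.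
move=> x Nx; have -> : 0 = window (F' `\` F)%fset 0 :> {ffun _ -> V}.
  by apply/ffunP => h; rewrite !ffunE.
have -> : 0 = window F' 0 :> {ffun _ -> V} by apply/ffunP => h; rewrite !ffunE.
move=> /eq_window x0; apply/eq_window => g F'g.
by have [Fg|nFg] := boolP (g \in F); [exact: Nx|apply: x0; rewrite inE nFg].
Qed.

(** For a set [T] of positions, let [U T] be the elements of [X] that look like
elements of [Z] on the translates of [Omega] by [T]. Adding to [T] a position
[g] separated from [T] makes the restrictions of [U T] shrink strictly: by
irreducibility there is an element of [U T] equal to the translate of [y] by [g]
on [g Omega] and to [0] on [T Omega], and it does not belong to [U (g |` T)].
Positions not separated from [g] lie in [g B], so a greedy choice in [F] finds at
least [#|F| / #|B|] separated positions. *)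
Lemma missing_pattern_dim X Z (Delta Omega : {fset G}) y :
  linear_set X -> linear_set Z -> Z `<=` X ->
  shift_invariant X -> shift_invariant Z -> irreducible_wrt Delta X ->
  X y -> ~ (exists2 z, Z z & {in Omega, z =1 y}) ->
  exists c : nat, forall F F' : {fset G}, {subset F ** Omega <= F'} ->
    (#|` F| + c * wdim F' Z <= c * wdim F' X)%N.
Proof.
move=> sX sZ ZX invX invZ irr Xy missing.
pose B := (1%g |` Omega ** inv_fset Delta ** inv_fset Omega)%fset.
exists #|` B| => F F' FF'.
pose sees g : set (G -> V) :=
  [set x | exists2 z, Z z & {in Omega, forall w, z (g * w)%g = x (g * w)%g}].
pose U (T : {fset G}) : set (G -> V) :=
  [set x | X x /\ {in T, forall g, sees g x}].
have sU T : linear_set (U T).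
  split.
    by split=> [|g _]; [case: sX|exists 0 => //; case: sZ].
  move=> a x x' [Xx Tx] [Xx' Tx']; split; first by case: sX => _; exact.
  move=> g Tg; have [z Zz zx] := Tx _ Tg; have [z' Zz' zx'] := Tx' _ Tg.
  exists (a *: z + z'); first by case: sZ => _; exact.
  by move=> w Ow; rewrite !fctE zx// zx'.
suff [T TF] : exists2 T, {subset T <= F} &
    (#|` F| + #|` B| * wdim F' (U T) <= #|` B| * wdim F' X)%N.
  apply: leq_trans; rewrite leq_add2l leq_mul2l wdimS ?orbT// => z Zz.
  by split=> [|g _]; [exact: ZX|exists z].
have [n] := ubnP #|` F|; elim: n F FF' => // n IH F FF' ltFn.
have [->|/fset0Pn[g Fg]] := eqVneq F fset0.
  exists fset0 => //; rewrite cardfs0 add0n leq_mul2l wdimS ?orbT//.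
  by move=> x [].
pose F1 := [fset h in F | (g^-1 * h)%g \notin B]%fset.
have F1E h : (h \in F1) = (h \in F) && ((g^-1 * h)%g \notin B).
  by rewrite in_fset.
have F1F : {subset F1 <= F} by move=> h; rewrite F1E => /andP[].
have ltF1 : (#|` F1| < #|` F|)%N.
  apply: fproper_ltn_card; rewrite fproperE; apply/andP; split.
    exact/fsubsetP.
  apply/negP => /fsubsetP/(_ g Fg).
  by rewrite F1E mulVg !inE eqxx andbF.
have leF : (#|` F| <= #|` F1| + #|` B|)%N.
  have : (#|` F| <= #|` (F1 `|` [fset (g * b)%g | b in B])%fset|)%N.
    apply/fsubset_leq_card/fsubsetP => h Fh; rewrite inE F1E Fh /=.
    case: (boolP (_ \in B)) => //= Bh; apply/imfsetP; exists (g^-1 * h)%g => //.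
    by rewrite mulVKg.
  move=> /leq_trans; apply; apply: leq_trans (leq_card_fsetU _ _).1 _.
  by rewrite leq_add2l leq_imfset_card.
have [||T TF1 IHT] := IH F1.
- move=> _ /mul_fsetP[h [w [/F1F Fh Ow ->]]].
  by apply: FF'; exact: mem_mul_fset.
- by apply: leq_trans ltF1 _.
exists (g |` T)%fset.
  by move=> h; rewrite !inE => /predU1P[->//|/TF1/F1F].
have sTg : U (g |` T)%fset `<=` U T.
  by move=> x [Xx Tx]; split=> // h Th; apply: Tx; rewrite inE Th orbT.
suff : (wdim F' (U (g |` T)%fset) < wdim F' (U T))%N by nia.
rewrite ltnNge; apply/negP => le_dim.
have /eqP eqU : vspace_of (window F' @` U (g |` T)%fset)
    == vspace_of (window F' @` U T).
  rewrite eqEdim le_dim andbT vspace_ofS//; [exact: linear_window..|].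
  exact: image_subset.
have [|x [Xx /eq_restr xg /eq_restr xT]] :=
  irr ([fset g] ** Omega)%fset (T ** Omega)%fset _ (shift g y) 0
    (invX g y Xy) sX.1.
  move=> [_ /mul_fsetP[t [w [/TF1 F1t Ow ->]]] /fset0Pn[h]].
  rewrite inE => /andP[/imfsetP[d /= Dd ->]].
  move=> /mul_fsetP[g' [w' []]]; rewrite inE => /eqP -> Ow' E.
  move: F1t; rewrite F1E !inE => /andP[_ /norP[_ /negP]]; apply.
  have -> : (g^-1 * t = w' * d^-1 * w^-1)%g.
    by apply: (mulgI g); rewrite mulVKg !mulgA -E !mulgK.
  by rewrite !mem_mul_fset// inv_fsetE invgK.
have : window F' x \in vspace_of (window F' @` U T).
  apply/vspace_ofP; first exact: linear_window.
  exists x => //; split=> // t Tt; exists 0; first by case: sZ.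
  by move=> w Ow; rewrite xT// mem_mul_fset.
rewrite -eqU => /vspace_ofP[|x' [_ x'see] /eq_window x'x].
  exact: linear_window.
(* Moved back by [g], the element [z] of [Z] would show the missing pattern. *)
have [|z Zz zx'] := x'see g; first by rewrite !inE eqxx.
apply: missing; exists (shift g^-1%g z); first exact: invZ.
move=> w Ow; rewrite /shift invgK zx'// x'x ?FF' ?mem_mul_fset//.
by rewrite xg ?mem_mul_fset ?inE// /shift mulKg.
Qed.

End Windows.

(** * Injectivity and surjectivity *)

Section InjectiveMaps.
Variables (G : groupType) (K : fieldType) (V : vectType K).

(** [X0], the elements of [X] supported near [F], approximates all of [X] on [F]
by truncation. The image of an element of [X0] is supported in [F'], so its
restriction to [F'] determines it, and then determines the element of [X0]
because [tau] is injective. *)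
Lemma injective_dim (X : set (G -> V)) (D Delta M : {fset G}) (L : set (D -> V))
    (tau : (G -> V) -> G -> V) :
  X = sft L -> linear_set X -> irreducible_wrt Delta X ->
  linear_on X tau -> local_on X M tau -> set_inj X tau ->
  exists S : {fset G}, forall F F' : {fset G}, {subset F ** S <= F'} ->
    (wdim F' X <= wdim F' (tau @` X) + #|` (F' `\` F)%fset| * dim V)%N.
Proof.
move=> XE sX irr lin loc inj.
pose S1 := (1%g |` inv_fset Delta)%fset.
exists (S1 ** inv_fset M) => F F' FF'.
pose X0 := [set x : G -> V | X x /\ forall g, g \notin F ** S1 -> x g = 0].
have sX0 : linear_set X0.
  split=> [|a x y [Xx x0] [Xy y0]]; first by split=> //; case: sX.
  split; first by case: sX => _; exact.
  by move=> g nBg; rewrite !fctE x0// y0// scaler0 addr0.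
have tau0 : tau 0 = 0 by exact: linear_on0 sX lin.
have linX0 : linear_on X0 tau by move=> a x y [Xx _] [Xy _]; exact: lin.
apply: leq_trans (@wdim_approx _ _ _ F F' _ _ sX sX0 _) _.
  move=> x Xx; have [x' Xx' [x'x x'0]] := truncate_to_finite F XE sX.1 irr Xx.
  by exists x'.
rewrite leq_add2r.
have lin_win : linear_on X0 (window F' \o tau).
  by move=> a x y X0x X0y; rewrite /= linX0// (@window_linear _ _ _ F' setT).
have sW := linear_set_image sX0 lin_win.
have sZ := linear_set_image sX lin.
apply: (@leq_trans (\dim (vspace_of ((window F' \o tau) @` X0)))).
  apply: rank_le => //; first exact: window_linear.
  move=> x [Xx x0] win0.
  suff -> : x = 0 by apply/ffunP => h; rewrite !ffunE.
  apply: inj; rewrite ?in_setE//; first exact: sX.1.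
  rewrite tau0; apply/funext => g.
  have [F'g|nF'g] := boolP (g \in F').
    by have /ffunP/(_ [` F'g]%fset) := win0; rewrite !ffunE.
  rewrite -[in RHS]tau0; apply: loc => // [|m Mm]; first exact: sX.1.
  apply: x0; apply: contra nF'g => /mul_fsetP[f [s [Ff S1s E]]].
  apply: FF'; apply/mul_fsetP; exists f, (s * m^-1)%g; split=> //.
    by apply: mem_mul_fset => //; rewrite inv_fsetE invgK.
  by rewrite mulgA -E mulgK.
apply/dimvS/vspace_ofS => //; first exact: linear_window.
by move=> _ [x [Xx _] <-]; exists (tau x) => //; exists x.
Qed.

End InjectiveMaps.

Theorem corollary1p3 (G : groupType) (K : fieldType) (V : vectType K)
    (X : set (G -> V)) :
  amenable G -> linear_subshift X -> strongly_irreducible X ->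
  finite_type X -> L_surjunctive X.
Proof.
move=> amG [subX submodX] [Delta irr] [D [L XE]].
move=> tau [[tauX [M [mu tauE]]] lin] inj.
have sX : linear_set X.
  case: submodX => X0 lX; split=> [|a x y Xx Xy]; first exact: set_mem.
  by apply: set_mem; apply: lX; apply: mem_set.
have loc : local_on X M tau.
  by move=> x y g Xx Xy xy; rewrite !tauE//; congr mu; exact: shift_restr.
have sZ : linear_set (tau @` X) by exact: linear_set_image.
have invZ : shift_invariant (tau @` X).
  move=> g _ [x Xx <-]; exists (shift g x); first exact: subX.2.
  apply/funext => h; rewrite /shift !tauE//; last exact: subX.2.
  by congr mu; apply/eq_restr => m _; rewrite /shift !invgK mulgA.
have [S dim_lower] := injective_dim XE sX irr lin loc inj.
move=> y Xy; suff appr : forall Omega : {fset G},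
    exists2 x, X x & {in Omega, tau x =1 y}.
  by have [x Xx <-] := image_closed subX sX loc lin appr; exists x.
move=> Omega; apply: contrapT => nOmega.
have ZX : tau @` X `<=` X by move=> _ [x Xx <-]; exact: tauX.
have missing : ~ exists2 z, (tau @` X) z & {in Omega, z =1 y}.
  by move=> [_ [x Xx <-] xy]; apply: nOmega; exists x.
have [c dim_upper] := missing_pattern_dim sX sZ ZX subX.2 invZ irr Xy missing.
have [F] := amenable_product (S `|` Omega)%fset (c * dim V) amG.
set F' := F ** _ => small.
have sub T : {subset T <= (S `|` Omega)%fset} -> {subset F ** T <= F'}.
  move=> TS _ /mul_fsetP[f [s [Ff Ts ->]]].
  by apply: mem_mul_fset => //; exact: TS.
have SF' : {subset F ** S <= F'} by apply: sub => s; rewrite inE => ->.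
have OF' : {subset F ** Omega <= F'}.
  by apply: sub => s; rewrite inE orbC => ->.
move: small; rewrite ltnNge => /negP; apply.
have := leq_trans (dim_upper F F' OF') (leq_mul (leqnn c) (dim_lower F F' SF')).
by rewrite mulnDr addnC leq_add2l [(_ * dim V)%N]mulnC mulnA.
Qed.
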